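(* For $\sigma>0$ and $\theta\in[0,2\pi)$, the $3$-Brownian shift $T_{\sigma,\theta}$ is not power bounded.
   Context: $H^2(\mathbb D)$ and $H^2(\mathbb D^2)$ are the Hardy spaces of the unit disk and bidisk (power series with square-summable coefficients, $\ell^2$ coefficient norm). The $3$-Brownian shift $T_{\sigma,\theta}$ acts on $H^2(\mathbb D^2)\oplus H^2(\mathbb D)\oplus\mathbb C$ by $T_{\sigma,\theta}(F,f,\alpha)=(z_1F+\sigma f_{z_2},\ zf+\sigma\alpha,\ e^{i\theta}\alpha)$, where $f_{z_2}(z_1,z_2):=f(z_2)$. A bounded operator $T$ is power bounded if the sequence $\{\|T^n\|\}_{n\ge0}$ is bounded. *)

(* Defs.v *)
From HB Require Import structures.
From mathcomp Require Import all_boot all_order all_algebra.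
From mathcomp Require Import complex.
From mathcomp Require Import all_classical all_reals all_analysis.
From mathcomp Require Import ring lra.

Set Implicit Arguments.
Unset Strict Implicit.
Unset Printing Implicit Defensive.

Import Order.TTheory GRing.Theory Num.Theory.
Import numFieldNormedType.Exports.
Import ComplexField.

Local Open Scope classical_set_scope.
Local Open Scope complex_scope.
Local Open Scope ring_scope.

Section ell2.
Variables (R : realType) (I : choiceType).
Implicit Types (a b : I -> R[i]).

Definition sqsum a : \bar R := \esum_(i in [set: I]) (Normc.normc (a i) ^+ 2)%:E.

Definition square_summable : {pred I -> R[i]} := [pred a | (sqsum a < +oo)%E].

Lemma minkowski2 (x y u v : R) : 0 <= x -> 0 <= y -> 0 <= u -> 0 <= v ->
  Num.sqrt ((x + y) ^+ 2 + (u + v) ^+ 2) <=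
  Num.sqrt (x ^+ 2 + u ^+ 2) + Num.sqrt (y ^+ 2 + v ^+ 2).
Proof.
move=> x0 y0 u0 v0.
have p0 : 0 <= x ^+ 2 + u ^+ 2 by rewrite addr_ge0 ?sqr_ge0.
have q0 : 0 <= y ^+ 2 + v ^+ 2 by rewrite addr_ge0 ?sqr_ge0.
have xy0 : 0 <= x * y + u * v by rewrite addr_ge0 ?mulr_ge0.
have cs : x * y + u * v <= Num.sqrt (x ^+ 2 + u ^+ 2) * Num.sqrt (y ^+ 2 + v ^+ 2).
  rewrite -sqrtrM// -[leLHS]ger0_norm// -sqrtr_sqr ler_wsqrtr//.
  by have := sqr_ge0 (x * v - u * y); nra.
have := sqr_sqrtr p0; have := sqr_sqrtr q0.
have := sqrtr_ge0 (x ^+ 2 + u ^+ 2); have := sqrtr_ge0 (y ^+ 2 + v ^+ 2).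
move: cs; set p := Num.sqrt (x ^+ 2 + u ^+ 2); set q := Num.sqrt (y ^+ 2 + v ^+ 2).
move=> cs q_ge0 p_ge0 qE pE.
rewrite -[leRHS]ger0_norm ?addr_ge0// -sqrtr_sqr ler_wsqrtr//; nra.
Qed.

Lemma normc_ge0 (z : R[i]) : 0 <= Normc.normc z.
Proof. by case: z => x y; exact: sqrtr_ge0. Qed.

Lemma normcE (z : R[i]) : `|z| = (Normc.normc z)%:C.
Proof. by []. Qed.

Lemma normc_triangle (z w : R[i]) :
  Normc.normc (z + w) <= Normc.normc z + Normc.normc w.
Proof. by rewrite -lecR rmorphD/= -!normcE ler_normD. Qed.

Lemma sqsum_ge0 a : (0 <= sqsum a)%E.
Proof. by apply: esum_ge0 => i _; rewrite lee_fin sqr_ge0. Qed.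

Lemma minkowski_seq (s : seq I) a b :
  Num.sqrt (\sum_(i <- s) Normc.normc (a i + b i) ^+ 2) <=
  Num.sqrt (\sum_(i <- s) Normc.normc (a i) ^+ 2) +
  Num.sqrt (\sum_(i <- s) Normc.normc (b i) ^+ 2).
Proof.
elim: s => [|i s IH]; first by rewrite !big_nil sqrtr0 addr0.
have s0 (c : I -> R[i]) : 0 <= \sum_(j <- s) Normc.normc (c j) ^+ 2.
  by apply: sumr_ge0 => j _; rewrite sqr_ge0.
have sE (c : I -> R[i]) : \sum_(j <- s) Normc.normc (c j) ^+ 2 =
    Num.sqrt (\sum_(j <- s) Normc.normc (c j) ^+ 2) ^+ 2.
  by rewrite sqr_sqrtr.
rewrite !big_cons (sE a) (sE b) (le_trans _ (minkowski2 _ _ _ _)) ?normc_ge0 ?sqrtr_ge0//.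
rewrite ler_wsqrtr// lerD//.
  by rewrite lerXn2r ?nnegrE ?addr_ge0 ?normc_ge0// normc_triangle.
by rewrite (sE (fun j => a j + b j)) lerXn2r ?nnegrE ?addr_ge0 ?sqrtr_ge0.
Qed.

Lemma sqsum_seq_le a (s : seq I) : uniq s ->
  ((\sum_(i <- s) Normc.normc (a i) ^+ 2)%:E <= sqsum a)%E.
Proof.
move=> us; rewrite -sumEFin.
have -> : \sum_(i <- s) (Normc.normc (a i) ^+ 2)%:E =
    \sum_(i \in [set` s]) (Normc.normc (a i) ^+ 2)%:E :> \bar R.
  by rewrite fsbig_seq.
by apply: ereal_sup_ubound; exists [set` s] => //; split => //; exact: finite_seq.
Qed.

Lemma sqsum_leP a (r : R) :
  (forall s : seq I, uniq s -> \sum_(i <- s) Normc.normc (a i) ^+ 2 <= r) ->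
  (sqsum a <= r%:E)%E.
Proof.
move=> h; apply: ge_ereal_sup => _ [A [finA _] <-].
by rewrite fsbig_finite//= sumEFin lee_fin h.
Qed.

Definition ell2_norm a : R := Num.sqrt (fine (sqsum a)).

Lemma ell2_norm_ge0 a : 0 <= ell2_norm a.
Proof. exact: sqrtr_ge0. Qed.

Lemma sqsumE a : a \in square_summable -> sqsum a = (ell2_norm a ^+ 2)%:E.
Proof.
rewrite inE => afin; rewrite sqr_sqrtr ?fine_ge0 ?sqsum_ge0// fineK//.
by rewrite ge0_fin_numE// sqsum_ge0.
Qed.

Lemma ell2_norm_le a (r : R) : 0 <= r ->
  (sqsum a <= (r ^+ 2)%:E)%E -> a \in square_summable /\ ell2_norm a <= r.
Proof.
move=> r0 h; have afin : a \in square_summable.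
  by rewrite inE (le_lt_trans h)// ltry.
split => //; move: h; rewrite sqsumE// lee_fin.
by rewrite ler_sqr ?nnegrE// ell2_norm_ge0.
Qed.

Lemma ell2_normD a b : a \in square_summable -> b \in square_summable ->
  a + b \in square_summable /\ ell2_norm (a + b) <= ell2_norm a + ell2_norm b.
Proof.
move=> afin bfin; have ab0 : 0 <= ell2_norm a + ell2_norm b.
  by rewrite addr_ge0 ?ell2_norm_ge0.
apply: ell2_norm_le => //; apply: sqsum_leP => s us.
have hs c : c \in square_summable ->
    Num.sqrt (\sum_(i <- s) Normc.normc (c i) ^+ 2) <= ell2_norm c.
  move=> cfin; rewrite -[leRHS]ger0_norm ?ell2_norm_ge0// -sqrtr_sqr.
  by rewrite ler_wsqrtr// -lee_fin -sqsumE// sqsum_seq_le.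
rewrite -[leLHS]sqr_sqrtr; last by apply: sumr_ge0 => i _; rewrite sqr_ge0.
rewrite lerXn2r ?nnegrE ?sqrtr_ge0// (le_trans (minkowski_seq _ _ _))//.
by rewrite lerD ?hs.
Qed.

Lemma ell2_normZ_le (c : R[i]) a : a \in square_summable ->
  c *: a \in square_summable /\ ell2_norm (c *: a) <= Normc.normc c * ell2_norm a.
Proof.
move=> afin; apply: ell2_norm_le; first by rewrite mulr_ge0 ?normc_ge0 ?ell2_norm_ge0.
apply: sqsum_leP => s us; rewrite exprMn.
under eq_bigr do rewrite Normc.normcM exprMn.
rewrite -mulr_sumr ler_wpM2l ?sqr_ge0//.
by rewrite -lee_fin -sqsumE// sqsum_seq_le.
Qed.

Lemma ell2_norm_coef a i : a \in square_summable -> Normc.normc (a i) <= ell2_norm a.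
Proof.
move=> afin; rewrite -(@ler_sqr R) ?nnegrE ?normc_ge0 ?ell2_norm_ge0//.
rewrite -lee_fin -sqsumE//.
by have := @sqsum_seq_le a [:: i] isT; rewrite big_seq1.
Qed.

Lemma square_summable0 : (0 : I -> R[i]) \in square_summable.
Proof.
apply: (ell2_norm_le (lexx 0) _).1; apply: sqsum_leP => s _.
by rewrite expr0n big1// => i _; rewrite Normc.normc0 expr0n.
Qed.

Lemma square_summable_submod : submod_closed square_summable.
Proof.
split; first exact: square_summable0.
move=> c a b afin bfin.
exact: (ell2_normD (ell2_normZ_le c afin).1 bfin).1.
Qed.

HB.instance Definition _ :=
  GRing.isSubmodClosed.Build R[i] (I -> R[i]) square_summable square_summable_submod.

Record ell2 := Ell2 { coef :> I -> R[i]; coefP : coef \in square_summable }.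

HB.instance Definition _ := [isSub for coef].
HB.instance Definition _ := [Choice of ell2 by <:].
HB.instance Definition _ := [SubChoice_isSubLmodule of ell2 by <:].

Let norm (f : ell2) : R[i] := (ell2_norm f)%:C.

Let normD (f g : ell2) : norm (f + g) <= norm f + norm g.
Proof. by rewrite /norm -rmorphD lecR; exact: (ell2_normD (coefP f) (coefP g)).2. Qed.

Let normZ (c : R[i]) (f : ell2) : norm (c *: f) = `|c| * norm f.
Proof.
rewrite normcE /norm -rmorphM; congr (_%:C); apply/eqP; rewrite eq_le.
rewrite (ell2_normZ_le c (coefP f)).2 /=.
have [->|c0] := eqVneq c 0; first by rewrite Normc.normc0 mul0r ell2_norm_ge0.
have n0 : 0 < Normc.normc c.
  rewrite lt_neqAle normc_ge0 andbT eq_sym; apply: contra c0.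
  by move=> /eqP/Normc.eq0_normc ->.
have fE : c^-1 *: coef (c *: f) = coef f.
  by rewrite (_ : coef (c *: f) = c *: coef f)// scalerA mulVf// scale1r.
have := (ell2_normZ_le c^-1 (coefP (c *: f))).2.
by rewrite fE Normc.normcV mulrC ler_pdivlMr// mulrC.
Qed.

Let norm0_eq0 (f : ell2) : norm f = 0 -> f = 0.
Proof.
case=> f0; apply: val_inj; apply/funext => i /=.
apply: Normc.eq0_normc; apply/eqP; rewrite eq_le normc_ge0 andbT.
by rewrite -f0 ell2_norm_coef// coefP.
Qed.

HB.instance Definition _ :=
  Lmodule_isNormed.Build R[i] ell2 normD normZ norm0_eq0.

Lemma ell2_normE (f : ell2) : `|f| = (ell2_norm f)%:C.
Proof. by []. Qed.

End ell2.

(* [U * V] already carries the maximum norm in the library; this alias carries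
   the Hilbert norm. *)
Definition hilbert_sum (C : numClosedFieldType) (U V : normedModType C) : Type :=
  (U * V)%type.

Section hilbert_sum.
Variables (C : numClosedFieldType) (U V : normedModType C).
Local Notation S := (hilbert_sum U V).

HB.instance Definition _ := GRing.Lmodule.copy S (U * V)%type.

Let norm (x : S) : C := sqrtC (`|x.1| ^+ 2 + `|x.2| ^+ 2).

Let sq_ge0 (x : S) : 0 <= `|x.1| ^+ 2 + `|x.2| ^+ 2.
Proof. by rewrite addr_ge0 ?exprn_ge0. Qed.

Let norm_ge0 (x : S) : 0 <= norm x. Proof. by rewrite sqrtC_ge0. Qed.

Let normE (x : S) : norm x ^+ 2 = `|x.1| ^+ 2 + `|x.2| ^+ 2.
Proof. by rewrite sqrtCK. Qed.

Let normD (x y : S) : norm (x + y) <= norm x + norm y.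
Proof.
have cs : `|x.1| * `|y.1| + `|x.2| * `|y.2| <= norm x * norm y.
  rewrite -(@ler_pXn2r _ 2)// ?nnegrE ?addr_ge0 ?mulr_ge0//.
  rewrite exprMn !normE -subr_ge0.
  have -> : (`|x.1| ^+ 2 + `|x.2| ^+ 2) * (`|y.1| ^+ 2 + `|y.2| ^+ 2) -
    (`|x.1| * `|y.1| + `|x.2| * `|y.2|) ^+ 2 =
    (`|x.1| * `|y.2| - `|x.2| * `|y.1|) ^+ 2 by ring.
  by rewrite real_exprn_even_ge0// rpredB// ger0_real// mulr_ge0.
rewrite -(@ler_pXn2r _ 2)// ?nnegrE ?addr_ge0//.
rewrite normE sqrrD !normE/=.
have le1 : `|x.1 + y.1| ^+ 2 <= (`|x.1| + `|y.1|) ^+ 2.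
  by rewrite lerXn2r ?nnegrE ?addr_ge0// ler_normD.
have le2 : `|x.2 + y.2| ^+ 2 <= (`|x.2| + `|y.2|) ^+ 2.
  by rewrite lerXn2r ?nnegrE ?addr_ge0// ler_normD.
apply: (le_trans (lerD le1 le2)).
have -> : (`|x.1| + `|y.1|) ^+ 2 + (`|x.2| + `|y.2|) ^+ 2 =
  `|x.1| ^+ 2 + `|x.2| ^+ 2 + (`|x.1| * `|y.1| + `|x.2| * `|y.2|) *+ 2 +
  (`|y.1| ^+ 2 + `|y.2| ^+ 2) by ring.
by rewrite lerD2r lerD2l lerMn2r cs.
Qed.

Let normZ (c : C) (x : S) : norm (c *: x) = `|c| * norm x.
Proof.
apply/eqP; rewrite -(@eqrXn2 _ 2)// ?mulr_ge0//.
by rewrite exprMn !normE/= !normrZ !exprMn mulrDr.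
Qed.

Let norm0_eq0 (x : S) : norm x = 0 -> x = 0.
Proof.
move=> x0; have /eqP := normE x; rewrite x0 expr0n eq_sym paddr_eq0 ?exprn_ge0//.
rewrite !expf_eq0/= !normr_eq0 => /andP[/eqP x1 /eqP x2].
by case: x {x0} x1 x2 => u v /= -> ->.
Qed.

HB.instance Definition _ := Lmodule_isNormed.Build C S normD normZ norm0_eq0.

Lemma hilbert_sum_normE (x : S) : `|x| = sqrtC (`|x.1| ^+ 2 + `|x.2| ^+ 2).
Proof. by []. Qed.

Lemma hilbert_sum_norm1 (x : S) : `|x.1| <= `|x|.
Proof.
by rewrite -(@ler_pXn2r _ 2)// ?nnegrE// [`|x|]hilbert_sum_normE sqrtCK lerDl exprn_ge0.
Qed.

Lemma hilbert_sum_norm2 (x : S) : `|x.2| <= `|x|.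
Proof.
by rewrite -(@ler_pXn2r _ 2)// ?nnegrE// [`|x|]hilbert_sum_normE sqrtCK lerDr exprn_ge0.
Qed.

Lemma hilbert_sum_norm_le (x : S) : `|x| <= `|x.1| + `|x.2|.
Proof.
rewrite -(@ler_pXn2r _ 2)// ?nnegrE ?addr_ge0// [`|x|]hilbert_sum_normE sqrtCK.
by rewrite sqrrD -addrA lerD2l addrC lerDl mulrn_wge0// mulr_ge0.
Qed.

End hilbert_sum.

Record bounded_operator (K : numFieldType) (V : normedModType K) := BoundedOperator {
  op :> {linear V -> V};
  op_bounded : bounded_near op (nbhs 0) }.

Section power_bounded.
Variables (R : realType) (V : normedModType R[i]).

(* Norms in a complex normed module are elements of [R[i]] with zero
   imaginary part, hence the real part below. *)
Definition opnorm (T : V -> V) : \bar R :=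
  ereal_sup [set (complex.Re `|T x|)%:E | x in [set x : V | `|x| <= 1]].

Definition power_bounded (T : bounded_operator V) : Prop :=
  exists M : R, forall n, (opnorm (iter n T) <= M%:E)%E.

Lemma opnorm_iter_lty (T : bounded_operator V) n : (opnorm (iter n T) < +oo)%E.
Proof.
have /linear_boundedP/pinfty_ex_gt0[r r0 Tr] := @op_bounded _ _ T.
have hn x : `|iter n T x| <= r ^+ n * `|x|.
  elim: n => [|n IH]; first by rewrite expr0 mul1r.
  by rewrite iterS (le_trans (Tr _))// exprS -mulrA ler_wpM2l// ltW.
apply: (@le_lt_trans _ _ (complex.Re (r ^+ n))%:E); last exact: ltry.
apply: ge_ereal_sup => _ [x /= x1 <-]; rewrite lee_fin.
have : `|iter n T x| <= r ^+ n.
  by rewrite (le_trans (hn x))// ler_piMr// exprn_ge0// ltW.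
by rewrite lecE => /andP[].
Qed.

End power_bounded.

(* An element of a Hardy space is the family of Taylor coefficients at the origin
   of a power series: [f n] is the coefficient of [z ^ n] and [F (m, n)] that of
   [z1 ^ m * z2 ^ n]. The values of these power series are given by [disk_value]
   and [bidisk_value] below. *)
Notation hardy_disk R := (ell2 R nat).
Notation hardy_bidisk R := (ell2 R (nat * nat)%type).

Section push.
Variables (R : realType) (I J : choiceType) (g : I -> J).
Variables (a : ell2 R I) (b : J -> R[i]).
Hypothesis g_inj : injective g.
Hypothesis bg : forall i, b (g i) = a i.
Hypothesis b0 : forall j, (forall i, g i <> j) -> b j = 0.

Lemma sqsum_push : sqsum b = sqsum a.
Proof.
rewrite /sqsum (esumID (range g))//; last by move=> j _; rewrite lee_fin sqr_ge0.
rewrite !setTI [X in (_ + X)%E]esum1 ?adde0; last first.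
  move=> j /= jg; rewrite b0 ?Normc.normc0 ?expr0n// => i gij.
  by apply: jg; exists i.
rewrite esum_image; last by move=> i j _ _; exact: g_inj.
by apply: eq_esum => i _; rewrite bg.
Qed.

Lemma push_square_summable : b \in @square_summable R J.
Proof. by rewrite inE sqsum_push; have := coefP a; rewrite inE. Qed.

Lemma push_norm (bP : b \in @square_summable R J) : `|Ell2 bP| = `|a|.
Proof. by congr (_%:C); rewrite /ell2_norm/= sqsum_push. Qed.

End push.

Section hardy.
Variable R : realType.
Implicit Types (f : hardy_disk R) (F : hardy_bidisk R) (z w : R[i]).

Definition mulz_coef f (n : nat) : R[i] := if n is m.+1 then f m else 0.

Lemma mulz_square_summable f : mulz_coef f \in @square_summable R nat.
Proof.
apply: (@push_square_summable _ _ _ S f) => //; first exact: succn_inj.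
by case=> // n /(_ n).
Qed.

Definition mulz f : hardy_disk R := Ell2 (mulz_square_summable f).

Definition mulz1_coef F (p : nat * nat) : R[i] :=
  if p.1 is m.+1 then F (m, p.2) else 0.

Let succ1 (p : nat * nat) := (p.1.+1, p.2).

Let succ1_inj : injective succ1.
Proof. by move=> [m n] [m' n'] [-> ->]. Qed.

Let mulz1_coefE F p : mulz1_coef F (succ1 p) = F p.
Proof. by case: p. Qed.

Let mulz1_coef0 F p : (forall q, succ1 q <> p) -> mulz1_coef F p = 0.
Proof. by case: p => [[|m] n] // /(_ (m, n)). Qed.

Lemma mulz1_square_summable F : mulz1_coef F \in @square_summable R (nat * nat)%type.
Proof. exact: (push_square_summable succ1_inj (mulz1_coefE F) (@mulz1_coef0 F)). Qed.

Definition mulz1 F : hardy_bidisk R := Ell2 (mulz1_square_summable F).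

Definition lift_z2_coef f (p : nat * nat) : R[i] :=
  if p.1 is 0 then f p.2 else 0.

Let axis2 (n : nat) := (0%N, n).

Let axis2_inj : injective axis2. Proof. by move=> n n' []. Qed.

Let lift_z2_coef0 f p : (forall n, axis2 n <> p) -> lift_z2_coef f p = 0.
Proof. by case: p => [[|m] n] // /(_ n). Qed.

Lemma lift_z2_square_summable f :
  lift_z2_coef f \in @square_summable R (nat * nat)%type.
Proof. exact: (push_square_summable axis2_inj _ (@lift_z2_coef0 f)). Qed.

Definition lift_z2 f : hardy_bidisk R := Ell2 (lift_z2_square_summable f).

Definition const_coef (c : R[i]) (n : nat) : R[i] := if n is 0 then c else 0.

Lemma const_sqsum c : sqsum (const_coef c) = (Normc.normc c ^+ 2)%:E.
Proof.
rewrite /sqsum (esumID [set 0%N])//; last by move=> j _; rewrite lee_fin sqr_ge0.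
rewrite !setTI esum_set1/= ?lee_fin ?sqr_ge0// esum1 ?adde0//.
by case=> [/(_ erefl)//|n _]; rewrite (Normc.normc0 R) expr0n.
Qed.

Lemma const_square_summable c : const_coef c \in @square_summable R nat.
Proof. by rewrite inE const_sqsum ltry. Qed.

Definition hardy_const c : hardy_disk R := Ell2 (const_square_summable c).

Lemma norm_mulz f : `|mulz f| = `|f|.
Proof.
by apply: (@push_norm _ _ _ S) => //; [exact: succn_inj | case=> // n /(_ n)].
Qed.

Lemma norm_mulz1 F : `|mulz1 F| = `|F|.
Proof. exact: (push_norm succ1_inj (mulz1_coefE F) (@mulz1_coef0 F)). Qed.

Lemma norm_lift_z2 f : `|lift_z2 f| = `|f|.
Proof. exact: (push_norm axis2_inj _ (@lift_z2_coef0 f)). Qed.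

Lemma norm_hardy_const c : `|hardy_const c| = `|c|.
Proof.
rewrite normcE; congr (_%:C); rewrite /ell2_norm/= const_sqsum/=.
by rewrite sqrtr_sqr ger0_norm ?normc_ge0.
Qed.

Definition disk_value f z w : Prop :=
  (fun N => \sum_(n < N) f n * z ^+ n : R[i]^o) @ \oo --> (w : R[i]^o).

Definition bidisk_value F z1 z2 w : Prop :=
  (fun MN : nat * nat => \sum_(m < MN.1) \sum_(n < MN.2)
    F (m : nat, n : nat) * z1 ^+ m * z2 ^+ n : R[i]^o) @ (\oo, \oo)
    --> (w : R[i]^o).

Lemma mulz_value f z w : disk_value f z w -> disk_value (mulz f) z (z * w).
Proof.
move=> fw; rewrite /disk_value -(cvg_shiftS _).
suff -> : (fun N => \sum_(n < N.+1) mulz f n * z ^+ n : R[i]^o) =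
          (fun N => z *: (\sum_(n < N) f n * z ^+ n : R[i]^o)) by exact: cvgZl_tmp.
apply/funext => N; rewrite big_ord_recl/= mul0r add0r scaler_sumr.
by apply: eq_bigr => i _; rewrite /= exprS mulrCA.
Qed.

Lemma mulz1_value F z1 z2 w :
  bidisk_value F z1 z2 w -> bidisk_value (mulz1 F) z1 z2 (z1 * w).
Proof.
move=> Fw; rewrite /bidisk_value.
pose P (MN : nat * nat) : R[i]^o := \sum_(m < MN.1) \sum_(n < MN.2)
    F (m : nat, n : nat) * z1 ^+ m * z2 ^+ n.
suff -> : (fun MN : nat * nat => \sum_(m < MN.1) \sum_(n < MN.2)
    mulz1 F (m : nat, n : nat) * z1 ^+ m * z2 ^+ n : R[i]^o) =
    (fun MN => z1 *: P (MN.1.-1, MN.2)).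
  apply: cvgZl_tmp; apply: (cvg_comp (fun MN : nat * nat => (MN.1.-1, MN.2)) P _ Fw).
  apply: cvg_pair; last exact: cvg_snd.
  apply: (cvg_comp fst predn cvg_fst) => A [N _ NA].
  by exists N.+1 => // -[|n]//= Nn; exact: NA.
apply/funext => -[[|M] N]/=.
  by rewrite /P/= !big_ord0 scaler0.
rewrite big_ord_recl big1 ?add0r => [|i _]; last by rewrite /= !mul0r.
rewrite /P scaler_sumr; apply: eq_bigr => i _; rewrite scaler_sumr.
by apply: eq_bigr => j _; rewrite /= exprS /GRing.scale/= -!mulrA mulrCA.
Qed.

Lemma lift_z2_value f z1 z2 w : disk_value f z2 w -> bidisk_value (lift_z2 f) z1 z2 w.
Proof.
move=> fw; pose P N : R[i]^o := \sum_(n < N) f n * z2 ^+ n.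
have : (P \o snd) @ (\oo, \oo) --> (w : R[i]^o).
  by apply: (cvg_comp snd P cvg_snd fw).
apply: cvg_trans; apply: near_eq_cvg.
exists ([set n | (0 < n)%N], setT) => /=.
  by split; [exists 1%N | exact: filterT].
move=> [[|M] N] [//= _ _]; rewrite big_ord_recl [X in _ + X]big1 ?addr0.
  by apply: eq_bigr => i _; rewrite /= expr0 mulr1.
by move=> i _; rewrite big1// => j _; rewrite /= !mul0r.
Qed.

Lemma hardy_const_value (c : R[i]) z : disk_value (hardy_const c) z c.
Proof.
rewrite /disk_value -(cvg_shiftS _).
suff -> : (fun N => \sum_(n < N.+1) hardy_const c n * z ^+ n : R[i]^o) =
          (fun=> c : R[i]^o) by exact: cvg_cst.
apply/funext => N; rewrite big_ord_recl/= expr0 mulr1 big1 ?addr0// => i _.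
by rewrite /= mul0r.
Qed.

Definition brownian_space : normedModType R[i] :=
  hilbert_sum (hilbert_sum (hardy_bidisk R) (hardy_disk R)) R[i]^o.

Definition expi (theta : R) : R[i] := cos theta +i* sin theta.

Lemma brownian_space_normE F f (alpha : R[i]) :
  `|(F, f, alpha) : brownian_space| =
  sqrtC (`|F| ^+ 2 + `|f| ^+ 2 + `|alpha| ^+ 2).
Proof.
by rewrite hilbert_sum_normE/= [X in X ^+ 2 + _]hilbert_sum_normE sqrtCK.
Qed.

Section brownian_shift.
Variables sigma theta : R.

Definition brownian_shift_fun (x : brownian_space) : brownian_space :=
  let: (F, f, alpha) := x in
  (mulz1 F + sigma%:C *: lift_z2 f,
   mulz f + hardy_const (sigma%:C * alpha),
   expi theta * alpha).

Let mulz_linear : linear mulz.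
Proof.
move=> c f g; apply: val_inj; apply/funext => -[|n] //=.
by change (0 = c * 0 + 0 :> R[i]); rewrite mulr0 addr0.
Qed.

Let mulz1_linear : linear mulz1.
Proof.
move=> c F G; apply: val_inj; apply/funext => -[[|m] n] //=.
by change (0 = c * 0 + 0 :> R[i]); rewrite mulr0 addr0.
Qed.

Let lift_z2_linear : linear lift_z2.
Proof.
move=> c f g; apply: val_inj; apply/funext => -[[|m] n] //=.
by change (0 = c * 0 + 0 :> R[i]); rewrite mulr0 addr0.
Qed.

Let hardy_const_linear (c a b : R[i]) :
  hardy_const (c * a + b) = c *: hardy_const a + hardy_const b.
Proof.
apply: val_inj; apply/funext => -[|n] //=.
by change (0 = c * 0 + 0 :> R[i]); rewrite mulr0 addr0.
Qed.

Let brownian_shift_linear : linear brownian_shift_fun.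
Proof.
move=> c [[F f] a] [[G g] b].
have h1 : mulz1 (c *: F + G) + sigma%:C *: lift_z2 (c *: f + g) =
    c *: (mulz1 F + sigma%:C *: lift_z2 f) + (mulz1 G + sigma%:C *: lift_z2 g).
  rewrite mulz1_linear lift_z2_linear !scalerDr !scalerA (mulrC sigma%:C c).
  exact: addrACA.
have h2 : mulz (c *: f + g) + hardy_const (sigma%:C * (c * a + b)) =
    c *: (mulz f + hardy_const (sigma%:C * a)) +
    (mulz g + hardy_const (sigma%:C * b)).
  rewrite mulz_linear mulrDr (mulrCA sigma%:C c a) hardy_const_linear scalerDr.
  exact: addrACA.
have h3 : expi theta * (c * a + b) = c * (expi theta * a) + expi theta * b.
  by rewrite mulrDr mulrCA.
exact: (congr2 pair (congr2 pair h1 h2) h3).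
Qed.

HB.instance Definition _ := GRing.isLinear.Build R[i] brownian_space brownian_space
  *:%R brownian_shift_fun brownian_shift_linear.

Let K : R[i] := 1 + `|sigma%:C| + (1 + `|sigma%:C|) + `|expi theta|.

Let brownian_shift_le (x : brownian_space) : `|brownian_shift_fun x| <= K * `|x|.
Proof.
case: x => [[F f] a]; set x : brownian_space := (F, f, a).
have lx1 : `|x.1| <= `|x| by exact: hilbert_sum_norm1.
have lF : `|F| <= `|x| by exact: le_trans (hilbert_sum_norm1 x.1) lx1.
have lf : `|f| <= `|x| by exact: le_trans (hilbert_sum_norm2 x.1) lx1.
have la : `|a| <= `|x| by exact: hilbert_sum_norm2 x.
apply: (le_trans (hilbert_sum_norm_le _)).
rewrite /K mulrDl lerD//; last by rewrite /= normrM ler_wpM2l.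
apply: (le_trans (hilbert_sum_norm_le _)).
rewrite /= mulrDl lerD//.
  rewrite (le_trans (ler_normD _ _))// mulrDl mul1r lerD//.
    by rewrite norm_mulz1.
  by rewrite normrZ norm_lift_z2 ler_wpM2l.
rewrite (le_trans (ler_normD _ _))// mulrDl mul1r lerD//.
  by rewrite norm_mulz.
by rewrite norm_hardy_const normrM ler_wpM2l.
Qed.

Lemma brownian_shift_bounded :
  bounded_near brownian_shift_fun (nbhs (0 : brownian_space)).
Proof.
apply/linear_boundedP; near=> r => x; apply: (le_trans (brownian_shift_le x)).
rewrite ler_wpM2r//; near: r; apply: nbhs_pinfty_ge.
by rewrite ger0_real// /K !addr_ge0.
Unshelve. all: by end_near. Qed.

Definition brownian_shift : bounded_operator brownian_space :=
  BoundedOperator brownian_shift_bounded.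

Lemma brownian_shiftE F f (alpha : R[i]) : brownian_shift (F, f, alpha) =
  (mulz1 F + sigma%:C *: lift_z2 f, mulz f + hardy_const (sigma%:C * alpha),
   expi theta * alpha).
Proof. by []. Qed.

End brownian_shift.
End hardy.

(* Main.v *)
Require Import Defs.
From mathcomp Require Import all_boot all_order all_algebra.
From mathcomp Require Import all_classical all_reals all_analysis.
From mathcomp Require Import complex.

Import Order.TTheory GRing.Theory Num.Theory.

Local Open Scope ring_scope.

(** The orbit of [(0, 1, 0)] already grows without bound. Since the disk
    component is merely shifted, it equals [z ^+ n] at time [n]; each step feeds
    [sigma * z2 ^+ n] into the bidisk component, which is otherwise multiplied
    by [z1]. Hence the bidisk component of the [n]-th iterate is
      [sigma * \sum_(k < n) z1 ^+ (n - 1 - k) * z2 ^+ k],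
    the sum of [n] distinct monomials with coefficient [sigma]
    ([brownian_orbit_coef]), and its squared norm is at least [n * sigma ^+ 2]
    ([ell2_norm_antidiagonal_ge]). A bound [M] on the norms of all iterates would
    give [n * sigma ^+ 2 <= M ^+ 2] for every [n], against the archimedean
    property. *)

Local Notation orbit_start R :=
  ((0, hardy_const 1, 0) : brownian_space R).

(** With no scalar component the constants [sigma * alpha] and the phase
    [expi theta] never enter the orbit, so its coefficients do not depend on
    [theta]. *)
Lemma brownian_orbit_coef (R : realType) (sigma theta : R) (n : nat) :
  let x := iter n (brownian_shift sigma theta) (orbit_start R) in
  [/\ forall i j, x.1.1 (i, j) = if (i + j).+1 == n then real_complex R sigma else 0,
      forall j, x.1.2 j = if j == n then 1 else 0
    & x.2 = 0].
Proof.
elim: n => [|n IH] /=; first by split => // -[].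
case: (iter n _ _) IH => -[F f] a /= [HF Hf ->].
split => /=; last by rewrite mulr0.
- move=> i j; rewrite eqSS.
  (* [mulz1] only reaches [i > 0] and [lift_z2] only [i = 0], so the new monomial
     never meets the shifted ones and nothing cancels. *)
  change (mulz1 F (i, j) + real_complex R sigma * lift_z2 f (i, j) =
    if (i + j)%N == n then real_complex R sigma else 0).
  case: i => [|i] /=; rewrite /mulz1_coef /lift_z2_coef /=.
    by rewrite add0r Hf add0n; case: eqP; rewrite ?mulr1 ?mulr0.
  by rewrite mulr0 addr0 HF.
- move=> j; rewrite mulr0.
  change (mulz f j + hardy_const 0 j = if j == n.+1 then 1 else 0).
  by case: j => [|j] /=; rewrite ?addr0 // Hf eqSS.
Qed.

(** Exactly [n] monomials have total degree [n - 1], and each contributes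
    [c ^+ 2] to the squared norm. *)
Lemma ell2_norm_antidiagonal_ge (R : realType) (F : hardy_bidisk R) (c : R)
    (n : nat) :
  (forall i j, (i + j).+1 = n -> F (i, j) = real_complex R c) ->
  n%:R * c ^+ 2 <= ell2_norm F ^+ 2.
Proof.
move=> HF; pose s := [seq ((n - k.+1)%N, k) | k <- iota 0 n].
have us : uniq s by rewrite map_inj_uniq ?iota_uniq // => k l [].
have := sqsum_seq_le F us.
rewrite sqsumE ?coefP // lee_fin; apply: le_trans.
rewrite big_map (eq_big_seq (fun=> c ^+ 2)) => [|k].
  by rewrite big_const_seq count_predT size_iota iter_addr_0 mulr_natl.
rewrite mem_iota add0n => /andP[_ kn].
rewrite HF; last by rewrite -addnS subnK.
by rewrite /= expr0n addr0 sqrtr_sqr real_normK ?num_real.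
Qed.

Lemma norm_orbit_start (R : realType) : `|orbit_start R| = 1.
Proof.
rewrite brownian_space_normE norm_hardy_const !normr0 normr1.
by rewrite !expr0n expr1n add0r addr0 sqrtC1.
Qed.

Lemma Re_norm_le_opnorm (R : realType) (V : normedModType (complex R))
    (T : V -> V) (x : V) :
  `|x| <= 1 -> ((complex.Re `|T x|)%:E <= opnorm T)%E.
Proof. by move=> x1; apply: ereal_sup_ubound; exists x. Qed.

Lemma ell2_norm_le_brownian (R : realType) (x : brownian_space R) :
  ell2_norm x.1.1 <= complex.Re `|x|.
Proof.
have : `|x.1.1| <= `|x|.
  exact: le_trans (hilbert_sum_norm1 x.1) (hilbert_sum_norm1 x).
by rewrite [`|x.1.1|]ell2_normE lecE => /andP[].
Qed.

Theorem proposition5p1 (R : realType) (sigma theta : R)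
    (sigma_gt0 : 0 < sigma) (theta_ge0 : 0 <= theta) (theta_lt2pi : theta < 2 * pi) :
  ~ power_bounded (brownian_shift sigma theta).
Proof.
case=> M TM.
have growth n : n%:R * sigma ^+ 2 <= M ^+ 2.
  have [HF _ _] := brownian_orbit_coef R sigma theta n.
  set x := iter n _ _ in HF.
  have xM : ell2_norm x.1.1 <= M.
    apply: (le_trans (ell2_norm_le_brownian _ _)); rewrite -lee_fin.
    apply: le_trans (TM n); apply: Re_norm_le_opnorm.
    by rewrite norm_orbit_start.
  have x0 := ell2_norm_ge0 x.1.1.
  apply: (@le_trans _ _ (ell2_norm x.1.1 ^+ 2)).
    by apply: ell2_norm_antidiagonal_ge => i j ijn; rewrite HF ijn eqxx.
  by rewrite ler_sqr ?nnegrE // (le_trans x0).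
have s2 : 0 < sigma ^+ 2 by rewrite exprn_gt0.
have := growth (Num.bound (M ^+ 2 / sigma ^+ 2)).
rewrite leNgt -ltr_pdivrMr // => /negP; apply.
by apply: archi_boundP; rewrite divr_ge0 ?sqr_ge0.
Qed.
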